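(* Let $n\ge1$. The sub-Riemannian distance from the north pole to a point of $\mathbb{S}^{2n+1}$ with cylindrical coordinates $(r,\theta)$ depends only on $r$ and $\theta$; denote it by $d(r,\theta)$. Then: (1) For $\theta\in[-\pi,\pi]$, $$d^2(0,\theta)=2\pi|\theta|-\theta^2.$$ (2) For $\theta\in[-\pi,\pi]$, $r\in\left(0,\frac\pi2\right)$, $$d^2(r,\theta)=\frac{(\varphi(r,\theta)+\theta)^2\tan^2r}{\sin^2(\varphi(r,\theta))},$$ where $\varphi(r,\theta)$ is the unique solution in $[-\pi,\pi]$ to the equation $$\varphi(r,\theta)+\theta=\cos r\sin\varphi(r,\theta)\,\frac{\arccos(\cos\varphi(r,\theta)\cos r)}{\sqrt{1-\cos^2r\cos^2\varphi(r,\theta)}}.$$ In particular, the sub-Riemannian diameter of $\mathbb{S}^{2n+1}$ is $\pi$.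
   Context: $\mathbb{S}^{2n+1}=\{z\in\mathbb{C}^{n+1}:\|z\|=1\}$ carries the sub-Laplacian $L=\Delta-T^2$, where $\Delta$ is the Laplace-Beltrami operator of the round metric and $Tf(z)=\frac{d}{d\theta}f(e^{i\theta}z)|_{\theta=0}$. The sub-Riemannian distance is the one associated with $L$: the horizontal distribution is the orthogonal complement of $T$ in the tangent bundle (the kernel of the contact form $\eta=-\frac i2\sum_{j=1}^{n+1}(\overline{z_j}dz_j-z_jd\overline{z_j})$), equipped with the restriction of the round metric, and the distance between two points is the infimum of the lengths of horizontal curves joining them. Cylindrical coordinates: a point with $z_{n+1}\ne0$ is written $z=\frac{1}{\sqrt{1+\rho^2}}(w_1e^{i\theta},\dots,w_ne^{i\theta},e^{i\theta})$ with $w\in\mathbb{C}^n$, $\rho^2=\sum|w_j|^2$, and $r\in[0,\pi/2)$ is defined by $\rho=\tan r$, so $z_{n+1}=\cos r\,e^{i\theta}$. The north pole is $(0,\dots,0,1)$, i.e. $r=0,\theta=0$. The existence and uniqueness of $\varphi(r,\theta)$ is known. When $\sin\varphi(r,\theta)=0$ (which happens for $\theta\in\{0,\pm\pi\}$), the quotient $\frac{\varphi(r,\theta)+\theta}{\sin\varphi(r,\theta)}$ is understood by continuity, i.e. as $\cos r\,\frac{\arccos(\cos\varphi(r,\theta)\cos r)}{\sqrt{1-\cos^2r\cos^2\varphi(r,\theta)}}$. *)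

(* Defs.v *)
(* Real analysis on Stdlib's R with Coquelicot; MathComp is used only for the
   finite index types 'I_n and for finite sums. *)
From HB Require Import structures.
From Stdlib Require Import Reals Lra.
From Coquelicot Require Import Coquelicot.
From mathcomp Require Import all_boot.

Set Implicit Arguments.
Unset Strict Implicit.
Unset Printing Implicit Defensive.

Local Open Scope R_scope.

Fact Rplus_assoc_sym : associative Rplus.
Proof. by move=> x y z; rewrite Rplus_assoc. Qed.

HB.instance Definition _ :=
  Monoid.isComLaw.Build R 0 Rplus Rplus_assoc_sym Rplus_comm Rplus_0_l.

(* Points and vectors of C^m are functions 'I_m -> C. *)

(* The Euclidean inner product of C^m = R^(2m). *)
Definition rinner (m : nat) (u v : 'I_m -> C) : R :=
  \big[Rplus/0]_(j < m) Re (u j * Cconj (v j))%C.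

Definition enorm (m : nat) (u : 'I_m -> C) : R := sqrt (rinner u u).

(* The unit sphere S^(2n+1) of C^(n+1). *)
Definition on_sphere (n : nat) (z : 'I_n.+1 -> C) : Prop := enorm z = 1.

(* e^(i theta) *)
Definition cis (theta : R) : C := (cos theta, sin theta).

(* The vector field T: the velocity of theta |-> e^(i theta) z at theta = 0. *)
Definition Tfield (n : nat) (z : 'I_n.+1 -> C) : 'I_n.+1 -> C :=
  fun j => (Ci * z j)%C.

(* Meaningful at the times where every coordinate of g is differentiable. *)
Definition velocity (n : nat) (g : R -> 'I_n.+1 -> C) (t : R) : 'I_n.+1 -> C :=
  fun j => (Derive (fun s => Re (g s j)) t, Derive (fun s => Im (g s j)) t).

(* f is C^1 on [a, b], up to the end points: f is continuous on [a, b], and its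
   derivative on ]a, b[ extends continuously to [a, b]. *)
Definition C1_on (a b : R) (f : R -> C) : Prop :=
  continuous_on (fun t => a <= t <= b) f /\
  exists f' : R -> C,
    continuous_on (fun t => a <= t <= b) f' /\
    forall t, a < t < b -> @is_derive R_AbsRing C_R_NormedModule f t (f' t).

(* Piecewise C^1 curves [0, 1] -> S^(2n+1) which are tangent to the horizontal
   distribution. The velocity of a curve drawn on the sphere is automatically
   tangent to the sphere, so that horizontality amounts to orthogonality to T
   (at the nodes s i, for both one-sided velocities, by continuity). *)
Definition horizontal_curve (n : nat) (g : R -> 'I_n.+1 -> C) : Prop :=
  (forall t, 0 <= t <= 1 -> on_sphere (g t)) /\
  exists (k : nat) (s : nat -> R),
    s 0%nat = 0 /\ s k = 1 /\
    forall i : nat, (i < k)%nat ->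
      s i < s i.+1 /\
      (forall j, C1_on (s i) (s i.+1) (fun t => g t j)) /\
      (forall t, s i < t < s i.+1 -> rinner (velocity g t) (Tfield (g t)) = 0).

(* The integrand is unspecified at the nodes of the subdivision, which does not
   affect the integral. *)
Definition curve_length (n : nat) (g : R -> 'I_n.+1 -> C) : R :=
  RInt (fun t => enorm (velocity g t)) 0 1.

Definition joining_length (n : nat) (p q : 'I_n.+1 -> C) (l : R) : Prop :=
  exists g : R -> 'I_n.+1 -> C,
    horizontal_curve g /\
    (forall j, g 0 j = p j) /\ (forall j, g 1 j = q j) /\
    l = curve_length g.

(* The sub-Riemannian distance; it is p_infty when no horizontal curve joins
   p to q. *)
Definition sr_dist (n : nat) (p q : 'I_n.+1 -> C) : Rbar :=
  Glb_Rbar (joining_length p q).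

Definition sr_diameter (n : nat) : Rbar :=
  Rbar_lub (fun x => exists p q : 'I_n.+1 -> C,
    on_sphere p /\ on_sphere q /\ x = sr_dist p q).

Definition north_pole (n : nat) : 'I_n.+1 -> C :=
  fun j => if j == ord_max then RtoC 1 else RtoC 0.

Arguments north_pole n : clear implicits.

(* The point (w_1 e^(i theta), ..., w_n e^(i theta), e^(i theta)) divided by
   sqrt (1 + |w|^2). *)
Definition cyl_point (n : nat) (w : 'I_n -> C) (theta : R) : 'I_n.+1 -> C :=
  fun j =>
    (RtoC (/ sqrt (1 + enorm w ^ 2)) *
     (if unlift ord_max j is Some k then w k * cis theta else cis theta))%C.

Definition acos_quotient (r phi : R) : R :=
  acos (cos phi * cos r) / sqrt (1 - cos r ^ 2 * cos phi ^ 2).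

Definition phi_solution (r theta phi : R) : Prop :=
  - PI <= phi <= PI /\
  phi + theta = cos r * sin phi * acos_quotient r phi.

(* (phi + theta) / sin phi, extended by continuity where sin phi = 0. *)
Definition phi_quotient (r theta phi : R) : R :=
  if Req_EM_T (sin phi) 0 then cos r * acos_quotient r phi
  else (phi + theta) / sin phi.

(* Main.v *)
(* Lower bound: along a horizontal curve g of length l from the north pole to q,
   rotate g by e^(i h) with h' = eta |g'|. As T is a unit field orthogonal to g',
   the rotated curve has speed sqrt (1 + eta^2) |g'|, so that its length bounds the
   Riemannian distance from the pole to its end point:
     acos (Re (e^(i eta l) q_(n+1))) <= sqrt (1 + eta^2) l.
   Taking eta = - b / l gives l^2 >= acos (Re (e^(- i b) q_(n+1)))^2 - b^2 for every b.

   Upper bound: the horizontal curves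
     e^(i b t) ((cos (a t) - i (b/a) sin (a t)) p + sqrt (1 - (b/a)^2) sin (a t) u),
   with u a unit vector Hermitian-orthogonal to p, have length sqrt (a^2 - b^2), and
   they reach equality in the lower bound when 0 < a <= PI and |b| <= a.

   With a = acos (cos r cos phi) and b = phi + theta, the equation defining phi says
   exactly that such a curve ends at the given point; it is the critical point equation
   of phi |-> acos (cos r cos phi)^2 - (phi + theta)^2, which is strictly concave.
   The curves join any two points of the sphere, whence the bound a <= PI on the
   diameter. *)
Require Import Defs.
From Stdlib Require Import Reals Lra.
From Coquelicot Require Import Coquelicot.
From mathcomp Require Import all_boot.
Local Open Scope R_scope.

(** * The equation defining phi *)

Lemma is_derive_acos x : -1 < x < 1 -> is_derive acos x (- / sqrt (1 - x ^ 2)).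
Proof.
  move=> hx; apply/is_derive_Reals.
  have h := derive_pt_acos x hx.
  have -> : - / sqrt (1 - x ^ 2) = derive_pt acos x (derivable_pt_acos x hx).
    by rewrite h /Rsqr /= Rmult_1_r; lra.
  exact: (proj2_sig (derivable_pt_acos x hx)).
Qed.

(** Mean value theorem: the derivative of [sin x - x * cos x] is [x * sin x]. This factor carries
    the sign of the derivative of [phi_gap]. *)
Lemma sub_mul_cos_sin_pos a : 0 < a <= PI -> 0 < sin a - a * cos a.
Proof.
  move=> ha.
  have [x [hx e]] : exists x, 0 < x < a /\
      (sin a - a * cos a) - (sin 0 - 0 * cos 0) = (x * sin x) * (a - 0).
    have h0 : 0 < a by lra.
    have [|x [e hx]] := MVT_cor2 (fun x => sin x - x * cos x) (fun x => x * sin x) 0 a h0.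
      move=> y _; apply/is_derive_Reals; auto_derive => //; ring.
    by exists x.
  have s0 : 0 < sin x by apply: sin_gt_0; lra.
  have h := Rmult_lt_0_compat _ _ (Rmult_lt_0_compat x (sin x) ltac:(lra) s0) (proj1 ha).
  rewrite sin_0 in e; lra.
Qed.

(** [acos_quotient] with a free modulus [c] in place of [cos r], so that any complex number of
    modulus below 1 can be treated. For [0 <= c < 1] it is [a / sin a] with
    [a = acos (cos phi * c)]. *)
Definition angle_quotient (c phi : R) : R :=
  acos (cos phi * c) / sqrt (1 - c ^ 2 * cos phi ^ 2).

(** Minus half the derivative in [phi] of [acos (cos phi * c) ^ 2 - (phi + theta) ^ 2]. *)
Definition phi_gap (c theta phi : R) : R :=
  phi + theta - c * sin phi * angle_quotient c phi.

Lemma cos_mul_lt1 c phi : 0 <= c < 1 -> -1 < cos phi * c < 1.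
Proof. move=> hc; have := COS_bound phi; nra. Qed.

Lemma sin_angle c phi : 0 <= c < 1 ->
  sin (acos (cos phi * c)) = sqrt (1 - c ^ 2 * cos phi ^ 2).
Proof.
  move=> hc; have h := cos_mul_lt1 c phi hc.
  rewrite sin_acos; last lra.
  by f_equal; rewrite /Rsqr; ring.
Qed.


Lemma phi_gapE c theta phi : 0 <= c < 1 ->
  let a := acos (cos phi * c) in
  phi_gap c theta phi = phi + theta - c * sin phi * (a / sin a).
Proof. by move=> hc a; rewrite /phi_gap /angle_quotient -sin_angle. Qed.

Lemma is_derive_phi_gap c theta phi : 0 <= c < 1 ->
  let a := acos (cos phi * c) in
  is_derive (phi_gap c theta) phi
    ((1 - c ^ 2) / sin a ^ 3 * (sin a - a * cos a)).
Proof.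
  move=> hc a.
  have h := cos_mul_lt1 c phi hc.
  have hs : 0 < sin a.
    by apply: sin_gt_0; have := acos_bound_lt _ h; rewrite -/a; lra.
  have ca : cos a = cos phi * c by rewrite /a cos_acos //; lra.
  have du : is_derive (fun x => acos (cos x * c)) phi (c * sin phi / sin a).
    have -> : c * sin phi / sin a =
       scal (- sin phi * c) (- / sqrt (1 - (cos phi * c) ^ 2)).
      rewrite /scal /= /mult /= /a sin_angle //.
      have -> : 1 - cos phi * c * (cos phi * c * 1) = 1 - c ^ 2 * cos phi ^ 2 by ring.
      rewrite /=; field; move: hs; rewrite /a sin_angle //=; lra.
    apply: (is_derive_comp acos (fun x => cos x * c)).
      exact: is_derive_acos.
    by auto_derive => //; ring.
  pose u x := acos (cos x * c).
  have eu := is_derive_unique _ _ _ du.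
  apply: (is_derive_ext (fun x => x + theta - c * sin x * (u x / sin (u x)))).
    by move=> x; rewrite phi_gapE.
  auto_derive.
    do 2 (split; first by eexists; exact: du).
    by split => //; move: hs; rewrite /a /u; lra.
  rewrite -/(u phi) [u phi]/u -/a -[Derive _ phi]/(Derive (fun x => acos (cos x * c)) phi) eu.
  have sn : sin phi * sin phi = 1 - cos phi * cos phi by have := sin2_cos2 phi; rewrite /Rsqr; lra.
  have sa : sin a * sin a = 1 - cos a * cos a by have := sin2_cos2 a; rewrite /Rsqr; lra.
  have e : c * sin phi * (c * sin phi) = c * c - cos a * cos a.
    by rewrite ca; transitivity (c * c * (sin phi * sin phi)); [ring|rewrite sn; ring].
  (* Once [c * cos phi] is also replaced by [cos a], what remains is a rational identity in [a],
     [sin a], [cos a] and [c * sin phi]. *)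
  have -> : 1 - c ^ 2 = sin a * sin a - c * sin phi * (c * sin phi) by rewrite sa e; ring.
  have e2 : c * cos phi = cos a by rewrite ca; ring.
  transitivity (1 - (c * cos phi * (a / sin a) + (c * sin phi) * (c * sin phi) * (sin a - a * cos a) / (sin a) ^ 3)).
    by field; lra.
  by rewrite e2; field; lra.
Qed.

Lemma phi_gap_increasing c theta x y : 0 <= c < 1 -> x < y ->
  phi_gap c theta x < phi_gap c theta y.
Proof.
  move=> hc hxy.
  have [|z [e hz]] := MVT_cor2 (phi_gap c theta) (fun x => let a := acos (cos x * c) in
      (1 - c ^ 2) / sin a ^ 3 * (sin a - a * cos a)) x y hxy.
    by move=> z _; apply/is_derive_Reals; apply: is_derive_phi_gap.
  have ha := acos_bound_lt _ (cos_mul_lt1 c z hc).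
  set a := acos _ in ha e.
  have h1 := sub_mul_cos_sin_pos a ltac:(lra).
  have h2 : 0 < sin a by apply: sin_gt_0; lra.
  have h3 : 0 < sin a ^ 3 by apply: pow_lt.
  have h4 : 0 < (1 - c ^ 2) / sin a ^ 3 by apply: Rdiv_lt_0_compat => //; nra.
  have h5 := Rmult_lt_0_compat _ _ h4 h1.
  rewrite /= in e h5; nra.
Qed.

(** Intermediate values: the sine vanishes at [PI] and [- PI], where the gap is [PI + theta >= 0]
    and [- PI + theta <= 0]. *)
Lemma phi_gap_root c theta : 0 <= c < 1 -> - PI <= theta <= PI ->
  exists phi, - PI <= phi <= PI /\ phi_gap c theta phi = 0.
Proof.
  move=> hc ht.
  have hpi := PI_RGT_0.
  have c0 : continuity (phi_gap c theta).
    move=> x; apply: derivable_continuous_pt.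
    by exists (Derive (phi_gap c theta) x); apply/is_derive_Reals/Derive_correct; eexists;
      exact: is_derive_phi_gap.
  have e1 : phi_gap c theta PI = PI + theta by rewrite /phi_gap sin_PI; ring.
  have e2 : phi_gap c theta (- PI) = - PI + theta by rewrite /phi_gap sin_neg sin_PI; ring.
  have [|x [hx e]] := IVT_gen (phi_gap c theta) (- PI) PI 0 c0.
    by rewrite e1 e2 Rmin_left ?Rmax_right; lra.
  by exists x; rewrite Rmin_left ?Rmax_right in hx; lra.
Qed.

(** * End points of geodesics in the unit disc *)

Lemma cisD x y : cis (x + y) = (cis x * cis y)%C.
Proof. by rewrite /cis /Cmult /= cos_plus sin_plus; f_equal; ring. Qed.

(* The last coordinate, at time 1, of the geodesic from the north pole with
   parameters a and b. *)
Definition geodesic_end (a b : R) : C := Cmult (cis b) (cos a, - (b / a * sin a)).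

(** The equation gives [b / a * sin a = c * sin phi], so that cos a - i (b/a) sin a = c e^(- i phi),
    which [cis b] turns into c e^(i theta). The last identity also yields [b ^ 2 <= a ^ 2]; for
    [c = cos r] it becomes the formula for the squared distance. *)
Lemma geodesic_end_of_phi c theta phi : 0 <= c < 1 -> phi_gap c theta phi = 0 ->
  let a := acos (cos phi * c) in let b := phi + theta in
  [/\ 0 < a <= PI, b ^ 2 <= a ^ 2, (RtoC c * cis theta)%C = geodesic_end a b
    & a ^ 2 - b ^ 2 = (1 - c ^ 2) * angle_quotient c phi ^ 2].
Proof.
  move=> hc e0 a b.
  have h := cos_mul_lt1 c phi hc.
  have ha : 0 < a < PI by apply: acos_bound_lt.
  have hs : 0 < sin a by apply: sin_gt_0; lra.
  have ca : cos a = cos phi * c by rewrite /a cos_acos //; lra.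
  rewrite phi_gapE // -/a in e0.
  have eq : angle_quotient c phi = a / sin a by rewrite /angle_quotient -sin_angle.
  have eb : b = c * sin phi * (a / sin a) by rewrite /b; lra.
  have sn : sin phi * sin phi = 1 - cos phi * cos phi by have := sin2_cos2 phi; rewrite /Rsqr; lra.
  have sa : sin a * sin a = 1 - cos a * cos a by have := sin2_cos2 a; rewrite /Rsqr; lra.
  have e : c * sin phi * (c * sin phi) = c * c - cos a * cos a.
    by rewrite ca; transitivity (c * c * (sin phi * sin phi)); [ring|rewrite sn; ring].
  have ed : a ^ 2 - b ^ 2 = (1 - c ^ 2) * (a / sin a) ^ 2.
    have -> : 1 - c ^ 2 = sin a * sin a - c * sin phi * (c * sin phi) by rewrite sa e; ring.
    by rewrite eb; field; lra.
  split.
  - lra.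
  - have : 0 <= (1 - c ^ 2) * (a / sin a) ^ 2 by apply: Rmult_le_pos; [nra|exact: pow2_ge_0].
    lra.
  - rewrite /geodesic_end.
    have -> : b / a * sin a = c * sin phi by rewrite eb; field; lra.
    rewrite ca (_ : cis b = cis phi * cis theta)%C; last by rewrite -cisD.
    rewrite /cis /Cmult /RtoC /=; f_equal.
      transitivity (c * cos theta * (cos phi * cos phi + sin phi * sin phi)); last by ring.
      by rewrite sn; ring.
    transitivity (c * sin theta * (cos phi * cos phi + sin phi * sin phi)); last by ring.
    by rewrite sn; ring.
  - by rewrite eq.
Qed.

(** The case of modulus 1, where [a] may not be taken from [phi]. For [a = PI] the end is - e^(i b),
    whence [b = theta - PI] or [b = theta + PI]; the sign of [theta] selects the one with |b| <=
    PI. *)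
Lemma geodesic_end_vertical theta : - PI <= theta <= PI ->
  exists b, [/\ b ^ 2 <= PI ^ 2, cis theta = geodesic_end PI b
    & PI ^ 2 - b ^ 2 = 2 * PI * Rabs theta - theta ^ 2].
Proof.
  move=> ht; have hpi := PI_RGT_0.
  have h b : geodesic_end PI b = (- cos b, - sin b).
    by rewrite /geodesic_end /cis /Cmult cos_PI sin_PI /=; f_equal; ring.
  case: (Rle_dec 0 theta) => t0.
    exists (theta - PI); rewrite h Rabs_pos_eq //; split; [nra| |ring].
    by rewrite /cis cos_minus sin_minus cos_PI sin_PI; f_equal; ring.
  exists (theta + PI); rewrite h Rabs_left; last lra.
  split; [nra| |ring].
  by rewrite /cis cos_plus sin_plus cos_PI sin_PI; f_equal; ring.
Qed.

Lemma polar_form (z : C) : exists theta, - PI <= theta <= PI /\ z = (RtoC (Cmod z) * cis theta)%C.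
Proof.
  case: z => x y; set c := Cmod _.
  have hpi := PI_RGT_0.
  have c0 : 0 <= c by apply: Cmod_ge_0.
  have cc : c * c = x * x + y * y.
    by rewrite /c /Cmod sqrt_sqrt //=; [ring|nra].
  rewrite /RtoC /cis /Cmult /=.
  case: (Req_dec c 0) => cz.
    exists 0; split; first lra.
    have ? : x = 0 by rewrite cz in cc; nra.
    have ? : y = 0 by rewrite cz in cc; nra.
    by subst; rewrite cz; f_equal; ring.
  have cpos : 0 < c by lra.
  have hx : -1 <= x / c <= 1.
    have ex : x / c * c = x by field.
    by split; apply: (Rmult_le_reg_r c) => //; rewrite ex; nra.
  have e := cos_acos _ hx; have es := sin_acos _ hx.
  have hb := acos_bound (x / c).
  have hy : c * sqrt (1 - (x / c)²) = Rabs y.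
    rewrite -{1}[c]sqrt_square // -sqrt_mult; [|nra|rewrite /Rsqr; nra].
    rewrite -sqrt_Rsqr_abs; f_equal; rewrite /Rsqr.
    transitivity (c * c - x * x); [by field|lra].
  have ex : x = c * (x / c) by field.
  (* The angle is [acos (x / c)] up to sign, and the sign of [y] decides. *)
  case: (Rle_dec 0 y) => y0.
    exists (acos (x / c)); split; first lra.
    rewrite e es; rewrite Rabs_pos_eq // in hy.
    by f_equal; lra.
  exists (- acos (x / c)); split; first lra.
  rewrite cos_neg sin_neg e es; rewrite Rabs_left in hy; last lra.
  by f_equal; lra.
Qed.

(** Modulus 1 is the vertical case; below 1 a root of [phi_gap] provides [a] and [b]. The disc
    contains all Hermitian products of unit vectors, so this serves for arbitrary pairs of
    points. *)
Lemma geodesic_end_surjective (z : C) : Cmod z <= 1 ->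
  exists a b, [/\ 0 < a <= PI, b ^ 2 <= a ^ 2 & z = geodesic_end a b].
Proof.
  move=> hz; have hpi := PI_RGT_0.
  have [theta [ht ez]] := polar_form z.
  case: (Req_dec (Cmod z) 1) => z1.
    have [b [h1 h2 _]] := geodesic_end_vertical theta ht.
    exists PI, b; split => //; first lra.
    by rewrite ez z1 -h2 Cmult_1_l.
  have hc : 0 <= Cmod z < 1 by have := Cmod_ge_0 z; lra.
  have [phi [hphi e]] := phi_gap_root (Cmod z) theta hc ht.
  have [h1 h2 h3 h4] := geodesic_end_of_phi _ _ _ hc e.
  by eexists _, _; split; [exact: h1|exact: h2|rewrite -h3].
Qed.

(** * Real and Hermitian inner products *)

Lemma big_Rmult_distr m a (F : 'I_m -> R) :
  a * \big[Rplus/0]_(j < m) F j = \big[Rplus/0]_(j < m) (a * F j).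
Proof.
  apply: (big_morph (Rmult a)); last exact: Rmult_0_r.
  by move=> x y; exact: Rmult_plus_distr_l.
Qed.

Lemma rinnerE m (u v : 'I_m -> C) :
  rinner u v = \big[Rplus/0]_(j < m) (Re (u j) * Re (v j) + Im (u j) * Im (v j)).
Proof. by apply: eq_bigr => j _; rewrite /Re /Im /=; ring. Qed.

Lemma rinner_sym m (u v : 'I_m -> C) : rinner u v = rinner v u.
Proof. by rewrite !rinnerE; apply: eq_bigr => j _; ring. Qed.

Lemma rinner_ext m (u u' v v' : 'I_m -> C) :
  (forall j, u j = u' j) -> (forall j, v j = v' j) -> rinner u v = rinner u' v'.
Proof. by move=> hu hv; apply: eq_bigr => j _; rewrite hu hv. Qed.

Lemma enorm_ext m (u u' : 'I_m -> C) : (forall j, u j = u' j) -> enorm u = enorm u'.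
Proof. by move=> h; rewrite /enorm (rinner_ext _ _ _ _ _ h h). Qed.

(** The scalar x + i y acts on vectors as x + y T. Later vectors carry explicit coefficients
    [RtoC 1] or [RtoC 0] in order to match this form. *)
Lemma rinner_comb n (a b : C) (p u v : 'I_n.+1 -> C) :
  rinner (fun j => a * p j + b * u j)%C v =
  Re a * rinner p v + Im a * rinner (Tfield p) v +
  (Re b * rinner u v + Im b * rinner (Tfield u) v).
Proof.
  rewrite !rinnerE !big_Rmult_distr -!big_split.
  by apply: eq_bigr => j _; rewrite /Re /Im /=; ring.
Qed.

Lemma rinner_Tfield_Tfield n (u v : 'I_n.+1 -> C) :
  rinner (Tfield u) (Tfield v) = rinner u v.
Proof. by rewrite !rinnerE; apply: eq_bigr => j _; rewrite /Re /Im /=; ring. Qed.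

Lemma rinner_Tfield_l n (u v : 'I_n.+1 -> C) :
  rinner (Tfield u) v = - rinner u (Tfield v).
Proof.
  have -> : - rinner u (Tfield v) = (-1) * rinner u (Tfield v) by ring.
  rewrite !rinnerE big_Rmult_distr; apply: eq_bigr => j _; rewrite /Re /Im /=; ring.
Qed.

Lemma rinner_Tfield_self n (u : 'I_n.+1 -> C) : rinner u (Tfield u) = 0.
Proof. have := rinner_Tfield_l _ u u; rewrite rinner_sym; lra. Qed.

Lemma big_Rplus_ge0 m (P : pred 'I_m) (F : 'I_m -> R) :
  (forall j, 0 <= F j) -> 0 <= \big[Rplus/0]_(j < m | P j) F j.
Proof. by move=> h; apply: (big_ind (fun x => 0 <= x)) => //; [lra|move=> *; lra]. Qed.

Lemma rinner_ge_coord m (u : 'I_m -> C) j : Re (u j) ^ 2 + Im (u j) ^ 2 <= rinner u u.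
Proof.
  rewrite rinnerE (bigD1 j) //=.
  set S := \big[_/_]_(_ < _ | _) _.
  have : 0 <= S by apply: big_Rplus_ge0 => k; nra.
  by lra.
Qed.

Lemma rinner_ge0 m (u : 'I_m -> C) : 0 <= rinner u u.
Proof. by rewrite rinnerE; apply: big_Rplus_ge0 => k; nra. Qed.

Lemma enorm_ge0 m (u : 'I_m -> C) : 0 <= enorm u.
Proof. exact: sqrt_pos. Qed.

Lemma enorm_sqr m (u : 'I_m -> C) : enorm u ^ 2 = rinner u u.
Proof. by rewrite /enorm pow2_sqrt //; exact: rinner_ge0. Qed.

Lemma on_sphere_rinner n (z : 'I_n.+1 -> C) : on_sphere z <-> rinner z z = 1.
Proof.
  rewrite /on_sphere; split => h; first by rewrite -enorm_sqr h; ring.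
  by rewrite /enorm h sqrt_1.
Qed.

Lemma rinner_Cauchy_Schwarz n (u v : 'I_n.+1 -> C) :
  rinner u v ^ 2 <= rinner u u * rinner v v.
Proof.
  have h t : 0 <= rinner u u + 2 * t * rinner u v + t ^ 2 * rinner v v.
    pose w j := (RtoC 1 * u j + RtoC t * v j)%C.
    have e x : rinner w x = rinner u x + t * rinner v x by rewrite rinner_comb /=; ring.
    have := rinner_ge0 _ w.
    by rewrite e (rinner_sym _ u) (rinner_sym _ v w) !e (rinner_sym _ v u); lra.
  have hu := rinner_ge0 _ u; have hv := rinner_ge0 _ v.
  case: (Req_dec (rinner v v) 0) => v0.
    rewrite v0; case: (Req_dec (rinner u v) 0) => [->|w0]; first lra.
    (* The quadratic polynomial is then affine in [t], and this [t] gives it the value -1. *)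
    have := h (- (rinner u u + 1) / (2 * rinner u v)).
    have -> : 2 * (- (rinner u u + 1) / (2 * rinner u v)) * rinner u v = - rinner u u - 1 by field.
    rewrite v0; lra.
  (* The minimum point of the quadratic polynomial. *)
  have := h (- rinner u v / rinner v v) => h1.
  have := Rmult_le_pos _ _ hv h1.
  have -> : rinner v v * (rinner u u + 2 * (- rinner u v / rinner v v) * rinner u v +
     (- rinner u v / rinner v v) ^ 2 * rinner v v) = rinner u u * rinner v v - rinner u v ^ 2 by field.
  lra.
Qed.

Definition vec2 m (j0 j1 : 'I_m) (a b : C) : 'I_m -> C :=
  fun j => if j == j0 then a else if j == j1 then b else RtoC 0.

Lemma rinner_vec2 m (j0 j1 : 'I_m) a b (p : 'I_m -> C) : j0 != j1 ->
  rinner p (vec2 m j0 j1 a b) =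
  (Re (p j0) * Re a + Im (p j0) * Im a) + (Re (p j1) * Re b + Im (p j1) * Im b).
Proof.
  move=> h; rewrite rinnerE (bigD1 j0) //= (bigD1 j1) /=; last by rewrite eq_sym.
  rewrite big1; last first.
    by move=> j /andP[h0 h1]; rewrite /vec2 (negbTE h0) (negbTE h1) /=; ring.
  by rewrite /vec2 eqxx [j1 == j0]eq_sym (negbTE h) eqxx Rplus_0_r.
Qed.

(** The last two conditions are the vanishing of the real and imaginary parts of the Hermitian
    product of [p] and [u]. *)
Definition hermitian_unit_normal n (p u : 'I_n.+1 -> C) : Prop :=
  [/\ rinner u u = 1, rinner p u = 0 & rinner p (Tfield u) = 0].

(** In two distinct coordinates, (conj p_1, - conj p_0) is Hermitian-orthogonal to (p_0, p_1); it is
    then normalized. If both coordinates of [p] vanish, a basis vector does. *)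
Lemma unit_normal_exists n (p : 'I_n.+1 -> C) : (1 <= n)%nat ->
  exists u, hermitian_unit_normal n p u.
Proof.
  move=> hn; pose j0 : 'I_n.+1 := ord0; pose j1 : 'I_n.+1 := ord_max.
  have hj : j0 != j1 by rewrite -val_eqE /= eq_sym -lt0n.
  have E a b : rinner (vec2 n.+1 j0 j1 a b) (vec2 n.+1 j0 j1 a b) =
      (Re a * Re a + Im a * Im a) + (Re b * Re b + Im b * Im b).
    by rewrite rinner_vec2 // /vec2 eqxx [j1 == j0]eq_sym (negbTE hj) eqxx.
  have ET a b : rinner p (Tfield (vec2 n.+1 j0 j1 a b)) =
      - ((Re (Tfield p j0) * Re a + Im (Tfield p j0) * Im a) +
         (Re (Tfield p j1) * Re b + Im (Tfield p j1) * Im b)).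
    by rewrite -rinner_vec2 // rinner_Tfield_l Ropp_involutive.
  have E0 a b : rinner p (vec2 n.+1 j0 j1 a b) =
      (Re (p j0) * Re a + Im (p j0) * Im a) + (Re (p j1) * Re b + Im (p j1) * Im b).
    exact: rinner_vec2.
  rewrite /Tfield /Re /Im /= in E E0 ET.
  move: E0 ET; case: (p j0) => x0 y0; case: (p j1) => x1 y1 /= E0 ET.
  pose W := x0 ^ 2 + y0 ^ 2 + x1 ^ 2 + y1 ^ 2.
  case: (Req_dec W 0) => hW.
    have [ex0 ey0] : x0 = 0 /\ y0 = 0 by rewrite /W in hW; split; nra.
    exists (vec2 n.+1 j0 j1 (RtoC 1) (RtoC 0)); split.
    - by rewrite E /=; ring.
    - by rewrite E0 ex0 ey0 /=; ring.
    - by rewrite ET /= ex0 ey0 /=; ring.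
  have Wp : 0 < W by have : 0 <= W; rewrite /W in hW *; nra.
  have sW := sqrt_lt_R0 _ Wp.
  have sq : / sqrt W * / sqrt W * W = 1.
    by rewrite -{3}(sqrt_sqrt W); [field; lra|lra].
  exists (vec2 n.+1 j0 j1 (x1 / sqrt W, - y1 / sqrt W) (- x0 / sqrt W, y0 / sqrt W)).
  split.
  - by rewrite E /= -sq; move: (sqrt W) sW => S sW; rewrite /W; field; lra.
  - by rewrite E0 /=; field; lra.
  - by rewrite ET /=; field; lra.
Qed.

(** [z] is the Hermitian product of [q] and [p], so [v = q - z p] is Hermitian-orthogonal to [p]
    with squared norm 1 - |z|^2. Then [u] is [v] normalized and turned by [cis (- b)], because the
    normal part of [geodesic] carries the factor [cis b] at time 1. *)
Lemma hermitian_decomposition n (p q : 'I_n.+1 -> C) b : (1 <= n)%nat ->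
  on_sphere p -> on_sphere q ->
  let z : C := (rinner q p, rinner q (Tfield p)) in
  Cmod z <= 1 /\
  exists u, hermitian_unit_normal n p u /\
    forall j, q j = (z * p j + RtoC (sqrt (1 - Cmod z ^ 2)) * (cis b * u j))%C.
Proof.
  move=> hn /on_sphere_rinner hp /on_sphere_rinner hq.
  set x := rinner q p; set y := rinner q (Tfield p) => z.
  have hT : rinner (Tfield q) p = - y by rewrite rinner_Tfield_l.
  pose v j := (RtoC 1 * q j + (- z) * p j)%C.
  have vp : rinner v p = 0.
    rewrite rinner_comb hp (rinner_sym _ (Tfield p)) rinner_Tfield_self /= -/x; ring.
  have vTp : rinner v (Tfield p) = 0.
    rewrite rinner_comb !rinner_Tfield_Tfield hp rinner_Tfield_self /= -/y; ring.
  have vq : rinner v q = 1 - (x ^ 2 + y ^ 2).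
    rewrite rinner_comb hq (rinner_sym _ p) (rinner_sym _ (Tfield p)) /= -/x -/y; ring.
  have vv : rinner v v = 1 - (x ^ 2 + y ^ 2).
    rewrite {2}/v rinner_sym rinner_comb (rinner_sym _ q) vq (rinner_sym _ p) vp
      (rinner_sym _ (Tfield p)) vTp /=; ring.
  have zz : Cmod z ^ 2 = x ^ 2 + y ^ 2.
    by rewrite /Cmod pow2_sqrt //=; nra.
  have z0 := Cmod_ge_0 z; have v0 := rinner_ge0 _ v.
  have z1 : Cmod z <= 1 by rewrite vv -zz in v0; nra.
  split=> //.
  have qv j : q j = (z * p j + v j)%C by rewrite /v; ring.
  set m := sqrt _.
  have mm : m * m = rinner v v by rewrite /m zz -vv; exact: sqrt_sqrt.
  (* Here [q = z p], and any unit normal will do. *)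
  case: (Req_dec m 0) => m0.
    have [u hu] := unit_normal_exists n p hn.
    exists u; split=> // j; rewrite {1}qv m0.
    have : v j = RtoC 0.
      have := rinner_ge_coord _ v j; rewrite -mm m0.
      case: (v j) => s t /= h; rewrite /RtoC; f_equal; nra.
    by move=> ->; rewrite Cmult_0_l.
  have cs : cos b * cos b + sin b * sin b = 1 by have := sin2_cos2 b; rewrite /Rsqr; lra.
  pose u j := (RtoC (/ m) * cis (- b) * v j + RtoC 0 * v j)%C.
  have Ts w : rinner (Tfield v) w = - rinner v (Tfield w) by exact: rinner_Tfield_l.
  have uw w : rinner u w = / m * (cos b * rinner v w + sin b * rinner v (Tfield w)).
    by rewrite /u rinner_comb Ts /= cos_neg sin_neg; ring.
  have TT w : rinner v (Tfield (Tfield w)) = - rinner v w.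
    by have := rinner_Tfield_Tfield _ v w; rewrite Ts; lra.
  exists u; split; last first.
    move=> j; rewrite {1}qv /u; f_equal.
    have e : (RtoC m * RtoC (/ m) = RtoC 1)%C by rewrite -RtoC_mult; f_equal; field.
    have e2 : (cis b * cis (- b) = RtoC 1)%C.
      by rewrite -cisD Rplus_opp_r /cis cos_0 sin_0.
    transitivity ((RtoC m * RtoC (/ m)) * (cis b * cis (- b)) * v j)%C.
      by rewrite e e2; ring.
    ring.
  split.
  - rewrite uw (rinner_sym _ v u) uw -(Ropp_involutive (rinner v (Tfield u))) -Ts.
    rewrite (rinner_sym _ (Tfield v)) uw rinner_Tfield_self TT -mm.
    transitivity (cos b * cos b + sin b * sin b) => //; field => //.
  - by rewrite rinner_sym uw vp vTp; ring.
  - rewrite -[rinner p _]Ropp_involutive -rinner_Tfield_l rinner_sym uw TT vp vTp; ring.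
Qed.

(** * Geodesics *)

Lemma is_derive_C (f g : R -> R) (t : R) (f' g' : R) :
  is_derive f t f' -> is_derive g t g' ->
  @is_derive R_AbsRing C_R_NormedModule (fun s => (f s, g s)) t (f', g').
Proof.
  move=> hf hg.
  apply: (filterdiff_ext_lin (V := C_R_NormedModule) _
    (fun y : R => ((scal y f', scal y g') : C_R_NormedModule))).
    apply: (filterdiff_comp_2 (W := C_R_NormedModule) f g (fun x y => (x, y)) _ _ (fun x y => (x, y)) hf hg).
    apply: (filterdiff_ext_lin _ (fun x => x)); last by case.
    apply: (filterdiff_ext (fun x => x)); first by case.
    exact: filterdiff_id.
  by [].
Qed.

Lemma is_derive_Re (f : R -> C) t l :
  @is_derive R_AbsRing C_R_NormedModule f t l -> is_derive (fun s => Re (f s)) t (Re l).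
Proof.
  move=> h.
  have h1 := filterdiff_comp' (V := C_R_NormedModule) f fst t _ fst h
     (filterdiff_linear _ (is_linear_fst (U := R_NormedModule) (V := R_NormedModule))).
  exact: h1.
Qed.

Lemma is_derive_Im (f : R -> C) t l :
  @is_derive R_AbsRing C_R_NormedModule f t l -> is_derive (fun s => Im (f s)) t (Im l).
Proof.
  move=> h.
  have h1 := filterdiff_comp' (V := C_R_NormedModule) f snd t _ snd h
     (filterdiff_linear _ (is_linear_snd (U := R_NormedModule) (V := R_NormedModule))).
  exact: h1.
Qed.

Lemma C1_on_of_smooth (f1 f2 g1 g2 : R -> R) a b :
  (forall t, is_derive f1 t (g1 t)) -> (forall t, is_derive f2 t (g2 t)) ->
  (forall t, ex_derive g1 t) -> (forall t, ex_derive g2 t) ->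
  C1_on a b (fun t => (f1 t, f2 t)).
Proof.
  have cont (h1 h2 : R -> R) : (forall t, ex_derive h1 t) -> (forall t, ex_derive h2 t) ->
      forall D, @continuous_on R_UniformSpace C_UniformSpace D (fun t => (h1 t, h2 t)).
    move=> e1 e2 D; apply: continuous_on_forall => t _.
    have [l1 d1] := e1 t; have [l2 d2] := e2 t.
    by apply: (ex_derive_continuous (V := C_R_NormedModule)); eexists; apply: is_derive_C; eassumption.
  move=> df1 df2 eg1 eg2; split.
    by apply: cont => t; eexists.
  exists (fun t => (g1 t, g2 t)); split; first exact: cont.
  by move=> t _; apply: is_derive_C.
Qed.

(* [geodesic_coef a b 1] is [geodesic_end a b]; the ratio is kept as [b / a] because
   [(b * t) / (a * t)] would be a junk value at [t = 0]. *)
Definition geodesic_coef (a b t : R) : C :=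
  Cmult (cis (b * t)) (cos (a * t), - (b / a * sin (a * t))).

(** The derivative in [t] of e^(i b t) sin (a t). *)
Definition geodesic_normal_speed (a b t : R) : C :=
  Cmult (cis (b * t)) (a * cos (a * t), b * sin (a * t)).

Definition geodesic n (p u : 'I_n.+1 -> C) (a b : R) (t : R) : 'I_n.+1 -> C :=
  fun j => (geodesic_coef a b t * p j +
            RtoC (sqrt (1 - (b / a) ^ 2) * sin (a * t)) * cis (b * t) * u j)%C.

(** In the derivative of the coefficient of [p], the terms i b cos (a t) cancel and leave a real
    multiple of e^(i b t). *)
Definition geodesic_velocity n (p u : 'I_n.+1 -> C) (a b : R) (t : R) : 'I_n.+1 -> C :=
  fun j => (RtoC (- (a * (1 - (b / a) ^ 2) * sin (a * t))) * cis (b * t) * p j +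
            RtoC (sqrt (1 - (b / a) ^ 2)) * geodesic_normal_speed a b t * u j)%C.

Lemma is_derive_geodesic n (p u : 'I_n.+1 -> C) a b t j : a <> 0 ->
  is_derive (fun s => Re (geodesic n p u a b s j)) t (Re (geodesic_velocity n p u a b t j)) /\
  is_derive (fun s => Im (geodesic n p u a b s j)) t (Im (geodesic_velocity n p u a b t j)).
Proof.
  move=> a0; rewrite /geodesic /geodesic_velocity /geodesic_coef /geodesic_normal_speed.
  rewrite /cis /RtoC /Cmult /Cplus /Re /Im /=.
  move: (sqrt _) (p j) (u j) => m [p1 p2] [u1 u2] /=.
  by split; auto_derive => //; field.
Qed.

Lemma ex_derive_geodesic_velocity n (p u : 'I_n.+1 -> C) a b t j :
  ex_derive (fun s => Re (geodesic_velocity n p u a b s j)) t /\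
  ex_derive (fun s => Im (geodesic_velocity n p u a b s j)) t.
Proof.
  rewrite /geodesic_velocity /geodesic_normal_speed /cis /RtoC /Cmult /Cplus /Re /Im /=.
  move: (b / a) (sqrt _) (p j) (u j) => k m [p1 p2] [u1 u2] /=.
  by split; auto_derive.
Qed.

(** The vectors [p], [Tfield p], [u], [Tfield u] are orthonormal over the reals. *)
Lemma rinner_hermitian_frame n (p u : 'I_n.+1 -> C) (a b a' b' : C) :
  rinner p p = 1 -> hermitian_unit_normal n p u ->
  rinner (fun j => a * p j + b * u j)%C (fun j => a' * p j + b' * u j)%C =
  Re a * Re a' + Im a * Im a' + Re b * Re b' + Im b * Im b'.
Proof.
  move=> hp [hu hpu hpTu].
  pose w j := (a' * p j + b' * u j)%C.
  have hup : rinner u p = 0 by rewrite rinner_sym.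
  have hTup : rinner (Tfield u) p = 0 by rewrite rinner_sym.
  have hTpu : rinner (Tfield p) u = 0 by rewrite rinner_Tfield_l hpTu; ring.
  have huTp : rinner u (Tfield p) = 0 by rewrite rinner_sym.
  have hpTp := rinner_Tfield_self _ p; have huTu := rinner_Tfield_self _ u.
  have hTpp : rinner (Tfield p) p = 0 by rewrite rinner_sym.
  have hTuu : rinner (Tfield u) u = 0 by rewrite rinner_sym.
  have e1 : rinner p w = Re a'.
    by rewrite rinner_sym rinner_comb hp hTpp hup hTup; ring.
  have e2 : rinner (Tfield p) w = Im a'.
    by rewrite rinner_sym rinner_comb !rinner_Tfield_Tfield hpTp hp huTp hup; ring.
  have e3 : rinner u w = Re b'.
    by rewrite rinner_sym rinner_comb hpu hTpu hu hTuu; ring.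
  have e4 : rinner (Tfield u) w = Im b'.
    by rewrite rinner_sym rinner_comb !rinner_Tfield_Tfield hpTu hpu hu huTu; ring.
  by rewrite rinner_comb e1 e2 e3 e4; ring.
Qed.

(** With k = b/a, the parts along [p] and [u] contribute - b (1 - k^2) sin^2 (a t) and its opposite
    to the product of the velocity with T, and the squared speed is the constant a^2 (1 - k^2). *)
Lemma geodesic_joining_length n (p q u : 'I_n.+1 -> C) a b :
  0 < a -> b ^ 2 <= a ^ 2 ->
  rinner p p = 1 -> hermitian_unit_normal n p u ->
  (forall j, q j = geodesic n p u a b 1 j) ->
  joining_length p q (sqrt (a ^ 2 - b ^ 2)).
Proof.
  move=> ha hb hp hu hq.
  have a0 : a <> 0 by lra.
  have hk : 0 <= 1 - (b / a) ^ 2.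
    have -> : 1 - (b / a) ^ 2 = (a ^ 2 - b ^ 2) * (/ a) ^ 2 by field.
    by apply: Rmult_le_pos; [lra|exact: pow2_ge_0].
  have mm : sqrt (1 - (b / a) ^ 2) * sqrt (1 - (b / a) ^ 2) = 1 - (b / a) ^ 2 by exact: sqrt_sqrt.
  have eb : b = (b / a) * a by field.
  have hv t : forall j, velocity (geodesic n p u a b) t j = geodesic_velocity n p u a b t j.
    move=> j; have [d1 d2] := is_derive_geodesic n p u a b t j a0.
    rewrite /velocity (is_derive_unique _ _ _ d1) (is_derive_unique _ _ _ d2).
    by case: (geodesic_velocity n p u a b t j).
  have cs x : cos x * cos x = 1 - sin x * sin x by have := sin2_cos2 x; rewrite /Rsqr; lra.
  have hn t : enorm (velocity (geodesic n p u a b) t) = sqrt (a ^ 2 - b ^ 2).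
    rewrite (enorm_ext _ _ _ (hv t)) /enorm; f_equal.
    rewrite /geodesic_velocity rinner_hermitian_frame //.
    rewrite /geodesic_coef /geodesic_normal_speed /cis /RtoC /Cmult /Re /Im /=.
    (* With [b = k * a], the goal is a polynomial identity modulo cos^2 + sin^2 = 1 and
       [m * m = 1 - k * k]. The same reduction is used below for the sphere and for
       horizontality. *)
    move: (cs (a * t)) (cs (b * t)) mm eb => c1 c2.
    move: (cos (a * t)) (sin (a * t)) (cos (b * t)) (sin (b * t)) (b / a) c1 c2 => ca sa cb sb k c1 c2.
    move: (sqrt _) => m mk ebk; rewrite ?ebk.
    have {}mk : m * m = 1 - k * k by rewrite mk; ring.
    by ring [c1 c2 mk].
  exists (geodesic n p u a b); split; last split; last split.
  - split.
      move=> t _; apply/on_sphere_rinner.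
      rewrite /geodesic rinner_hermitian_frame //.
      rewrite /geodesic_coef /geodesic_normal_speed /cis /RtoC /Cmult /Re /Im /=.
      move: (cs (a * t)) (cs (b * t)) mm eb => c1 c2.
      move: (cos (a * t)) (sin (a * t)) (cos (b * t)) (sin (b * t)) (b / a) c1 c2 => ca sa cb sb k c1 c2.
      move: (sqrt _) => m mk ebk; rewrite ?ebk.
      have {}mk : m * m = 1 - k * k by rewrite mk; ring.
      by ring [c1 c2 mk].
    (* A single piece, with nodes [INR 0 = 0] and [INR 1 = 1]. *)
    exists 1%nat, INR; split => //; split => // i hi.
    split; first by rewrite S_INR; lra.
    split.
      move=> j; apply: C1_on_of_smooth.
      + by move=> t; exact: (proj1 (is_derive_geodesic n p u a b t j a0)).
      + by move=> t; exact: (proj2 (is_derive_geodesic n p u a b t j a0)).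
      + by move=> t; exact: (proj1 (ex_derive_geodesic_velocity n p u a b t j)).
      + by move=> t; exact: (proj2 (ex_derive_geodesic_velocity n p u a b t j)).
    move=> t _.
    rewrite (rinner_ext _ _ _ _ _ (hv t) (fun j => erefl)).
    pose A := geodesic_coef a b t.
    pose B := (RtoC (sqrt (1 - (b / a) ^ 2) * sin (a * t)) * cis (b * t))%C.
    rewrite (rinner_ext _ _ _ (Tfield (geodesic n p u a b t))
      (fun j => (Ci * A) * p j + (Ci * B) * u j)%C (fun j => erefl)); last first.
      by move=> j; rewrite /Tfield /geodesic -/A -/B; ring.
    rewrite /geodesic_velocity rinner_hermitian_frame // /A /B.
    rewrite /Ci /geodesic_coef /geodesic_normal_speed /cis /RtoC /Cmult /Re /Im /=.
    move: (cs (a * t)) (cs (b * t)) mm eb => c1 c2.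
    move: (cos (a * t)) (sin (a * t)) (cos (b * t)) (sin (b * t)) (b / a) c1 c2 => ca sa cb sb k c1 c2.
    move: (sqrt _) => m mk ebk; rewrite ?ebk.
    have {}mk : m * m = 1 - k * k by rewrite mk; ring.
    by ring [c1 c2 mk].
  - move=> j; rewrite /geodesic.
    rewrite /geodesic_coef /cis !Rmult_0_r cos_0 sin_0 /RtoC !Rmult_0_r Ropp_0 -/(RtoC 1) -/(RtoC 0).
    ring.
  - by move=> j; rewrite hq.
  - rewrite /curve_length (RInt_ext _ (fun _ => sqrt (a ^ 2 - b ^ 2))); last by [].
    by rewrite RInt_const /scal /= /mult /=; ring.
Qed.

(** The normal parts agree because 1 - |z|^2 = (1 - (b/a)^2) sin^2 a for [z = geodesic_end a b]. *)
Lemma joining_length_of_geodesic_end n (p q : 'I_n.+1 -> C) a b : (1 <= n)%nat ->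
  on_sphere p -> on_sphere q -> 0 < a <= PI -> b ^ 2 <= a ^ 2 ->
  (rinner q p, rinner q (Tfield p)) = geodesic_end a b ->
  joining_length p q (sqrt (a ^ 2 - b ^ 2)).
Proof.
  move=> hn hp hq ha hb e.
  have [z1 [u [hu hj]]] := hermitian_decomposition n p q b hn hp hq.
  move/on_sphere_rinner: hp => hp.
  apply: (geodesic_joining_length _ _ _ u) => //; first lra.
  move=> j; rewrite hj /geodesic e.
  have hk : 0 <= 1 - (b / a) ^ 2.
    have -> : 1 - (b / a) ^ 2 = (a ^ 2 - b ^ 2) * (/ a) ^ 2 by field; lra.
    by apply: Rmult_le_pos; [lra|exact: pow2_ge_0].
  (* The bound [a <= PI] fixes the sign when the square root is taken. *)
  have sa : 0 <= sin a by apply: sin_ge_0; lra.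
  have -> : sqrt (1 - Cmod (geodesic_end a b) ^ 2) = sqrt (1 - (b / a) ^ 2) * sin a.
    rewrite -{1}(sqrt_pow2 _ sa) -sqrt_mult //; last exact: pow2_ge_0.
    f_equal; rewrite /Cmod pow2_sqrt; last by apply: Rplus_le_le_0_compat; exact: pow2_ge_0.
    rewrite /geodesic_end /cis /Cmult /=.
    have cs x : cos x * cos x = 1 - sin x * sin x by have := sin2_cos2 x; rewrite /Rsqr; lra.
    by move: (b / a) (cos a) (sin a) (cos b) (sin b) (cs a) (cs b) => k c1 s1 c2 s2 h1 h2; ring [h1 h2].
  rewrite /geodesic_coef /geodesic_end !Rmult_1_r; ring.
Qed.

Lemma pow2_le_abs y z : y ^ 2 <= z ^ 2 -> 0 <= z -> - z <= y <= z.
Proof. by move=> h hz; nra. Qed.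

(** * The lower bound *)

(* Differentiating [Re (e^(i h) z_j)] with [h' = eta] amounts to moving along
   [v + eta T(z)], a vector orthogonal to [z] with squared norm [|v|^2 + eta^2]. *)
Lemma rotated_height_speed n (z v : 'I_n.+1 -> C) j h eta :
  rinner z z = 1 -> rinner v z = 0 -> rinner v (Tfield z) = 0 ->
  let X := cos h * Re (z j) - sin h * Im (z j) in
  X ^ 2 <= 1 /\
  (cos h * (Re (v j) - eta * Im (z j)) - sin h * (Im (v j) + eta * Re (z j))) ^ 2
    <= (rinner v v + eta ^ 2) * (1 - X ^ 2).
Proof.
  move=> hz hvz hvT X.
  have cs : cos h * cos h = 1 - sin h * sin h by have := sin2_cos2 h; rewrite /Rsqr; lra.
  (* The product of any [w] with this unit vector is Re (e^(i h) w_j). *)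
  pose e i : C := if i == j then (cos h, - sin h) else RtoC 0.
  have re w : rinner w e = cos h * Re (w j) - sin h * Im (w j).
    rewrite rinnerE (bigD1 j) //= big1 => [|i hi].
      by rewrite /e eqxx /Re /Im /=; ring.
    by rewrite /e (negbTE hi) /Re /Im /=; ring.
  have ee : rinner e e = 1 by rewrite re /e eqxx /Re /Im /=; ring [cs].
  pose w i := (RtoC 1 * v i + RtoC eta * Tfield z i)%C.
  pose f i := (RtoC 1 * e i + RtoC (- X) * z i)%C.
  have zT := rinner_Tfield_self _ z.
  have wz : rinner w z = 0.
    by rewrite rinner_comb hvz (rinner_sym _ (Tfield z)) zT /=; ring.
  have vw : rinner v w = rinner v v.
    by rewrite rinner_sym rinner_comb (rinner_sym _ (Tfield z)) hvT /=; ring.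
  have Tw : rinner (Tfield z) w = eta.
    rewrite rinner_sym rinner_comb hvT !rinner_Tfield_Tfield hz /=; ring.
  have ww : rinner w w = rinner v v + eta ^ 2.
    rewrite {1}/w rinner_comb vw Tw /=; ring.
  have ez : rinner e z = X by rewrite rinner_sym re.
  have ff : rinner f f = 1 - X ^ 2.
    have fe : rinner f e = 1 - X ^ 2 by rewrite rinner_comb ee (rinner_sym _ z) ez /=; ring.
    have fz : rinner f z = 0 by rewrite rinner_comb ez hz /=; ring.
    by rewrite {1}/f rinner_comb (rinner_sym _ e) fe (rinner_sym _ z) fz /=; ring.
  have wf : rinner w f = cos h * (Re (v j) - eta * Im (z j)) - sin h * (Im (v j) + eta * Re (z j)).
    rewrite rinner_sym rinner_comb (rinner_sym _ e) re (rinner_sym _ z) wz.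
    by rewrite /w /Tfield /Re /Im /=; ring.
  split; first by have := rinner_ge0 _ f; rewrite ff; lra.
  by rewrite -wf -ww -ff; exact: rinner_Cauchy_Schwarz.
Qed.

(** * Calculus along one piece of a curve *)

(** Composition with [clamp a b] extends a function on [a, b] by its end values, turning continuity
    on the segment into continuity at every real. *)
Definition clamp (a b t : R) : R := Rmax a (Rmin b t).

Lemma clamp_id a b t : a <= t <= b -> clamp a b t = t.
Proof. by move=> h; rewrite /clamp Rmin_right ?Rmax_right; lra. Qed.

Lemma clamp_bounds a b t : a <= b -> a <= clamp a b t <= b.
Proof.
  move=> h; rewrite /clamp /Rmin; case: (Rle_dec b t) => ?;
    rewrite /Rmax; case: (Rle_dec a _) => ?; lra.
Qed.

Lemma continuous_clamp (U : UniformSpace) (f : R -> U) a b x : a <= b ->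
  continuous_on (fun t : R_UniformSpace => a <= t <= b) f ->
  continuous (fun t => f (clamp a b t)) x.
Proof.
  move=> hab hf P hP.
  have [d hd] := hf _ (clamp_bounds a b x hab) P hP.
  exists d => y hy; apply: hd; last exact: (clamp_bounds a b y hab).
  move: hy; rewrite /ball /= /AbsRing_ball /= /abs /minus /plus /opp /=.
  move=> /Rabs_def2 hy; apply: Rabs_def1;
    rewrite /clamp /Rmin; case: (Rle_dec b x) => ?; case: (Rle_dec b y) => ?;
    rewrite /Rmax; repeat case: (Rle_dec a _) => ?; lra.
Qed.

(** Clamping thus leaves derivatives at interior points unchanged. *)
Lemma locally_clamp (U : Type) (f : R -> U) a b t : a < t < b ->
  locally t (fun s => f (clamp a b s) = f s).
Proof.
  move=> ht; have hd : 0 < Rmin (t - a) (b - t) by apply: Rmin_glb_lt; lra.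
  exists (mkposreal _ hd) => s; rewrite /ball /= /AbsRing_ball /= /abs /minus /plus /opp /= => hs.
  rewrite clamp_id //.
  have := Rmin_l (t - a) (b - t); have := Rmin_r (t - a) (b - t).
  by move: hs => /Rabs_def2; lra.
Qed.

Lemma continuous_big_Rplus m (F : 'I_m -> R -> R) (t : R) :
  (forall j, continuous (F j) t) ->
  continuous (fun s => \big[Rplus/0]_(j < m) F j s) t.
Proof.
  move=> h; elim: (index_enum _) => [|j r IH].
    apply: (continuous_ext (fun _ => 0)); last exact: continuous_const.
    by move=> s; rewrite big_nil.
  apply: (continuous_ext (fun s => F j s + \big[Rplus/0]_(i <- r) F i s)).
    by move=> s; rewrite big_cons.
  exact: (continuous_plus (F j) _ t (h j) IH).
Qed.

Lemma is_derive_big_Rplus m (F : 'I_m -> R -> R) (l : 'I_m -> R) (t : R) :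
  (forall j, is_derive (F j) t (l j)) ->
  is_derive (fun s => \big[Rplus/0]_(j < m) F j s) t (\big[Rplus/0]_(j < m) l j).
Proof.
  move=> h; elim: (index_enum _) => [|j r IH].
    rewrite big_nil; apply: (is_derive_ext (fun _ => 0)); last exact: is_derive_const.
    by move=> s; rewrite big_nil.
  rewrite big_cons.
  apply: (is_derive_ext (fun s => F j s + \big[Rplus/0]_(i <- r) F i s)).
    by move=> s; rewrite big_cons.
  exact: (is_derive_plus (F j) _ t _ _ (h j) IH).
Qed.

Lemma continuous_enorm m (f : R -> 'I_m -> C) (t : R) :
  (forall j, @continuous R_UniformSpace C_UniformSpace (fun s => f s j) t) ->
  continuous (fun s => enorm (f s)) t.
Proof.
  move=> h.
  apply: (continuous_comp (fun s => rinner (f s) (f s)) sqrt); last exact: continuous_sqrt.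
  apply: (continuous_ext (fun s => \big[Rplus/0]_(j < m)
     (Re (f s j) * Re (f s j) + Im (f s j) * Im (f s j)))).
    by move=> s; rewrite rinnerE.
  apply: continuous_big_Rplus => j.
  have h1 : continuous (fun s => Re (f s j)) t.
    apply: (continuous_comp (V := C_UniformSpace) _ fst); first exact: h.
    by rewrite [f t j]surjective_pairing; exact: continuous_fst.
  have h2 : continuous (fun s => Im (f s j)) t.
    apply: (continuous_comp (V := C_UniformSpace) _ snd); first exact: h.
    by rewrite [f t j]surjective_pairing; exact: continuous_snd.
  apply: (continuous_plus (V := R_NormedModule)); exact: (continuous_mult (K := R_AbsRing)).
Qed.

(** Differentiate |g|^2 = 1. *)
Lemma velocity_orthogonal n (g : R -> 'I_n.+1 -> C) (v : 'I_n.+1 -> C) (t : R) :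
  (forall j, @is_derive R_AbsRing C_R_NormedModule (fun s => g s j) t (v j)) ->
  locally t (fun s => rinner (g s) (g s) = 1) -> rinner v (g t) = 0.
Proof.
  move=> hv hs.
  have d1 : is_derive (fun s => rinner (g s) (g s)) t (2 * rinner v (g t)).
    apply: (is_derive_ext (fun s => \big[Rplus/0]_j (Re (g s j) * Re (g s j) + Im (g s j) * Im (g s j)))).
      by move=> s; rewrite rinnerE.
    rewrite rinnerE big_Rmult_distr; apply: is_derive_big_Rplus => j.
    have h1 := is_derive_Re _ _ _ (hv j); have h2 := is_derive_Im _ _ _ (hv j).
    move: h1 h2; set f1 := fun s : R => Re (g s j); set f2 := fun s : R => Im (g s j) => h1 h2.
    rewrite -/(f1 t) -/(f2 t).
    apply: (is_derive_ext (fun s => f1 s * f1 s + f2 s * f2 s)) => //.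
    have e1 : ex_derive f1 t by eexists; exact: h1.
    have e2 : ex_derive f2 t by eexists; exact: h2.
    auto_derive; first by tauto.
    by rewrite (is_derive_unique _ _ _ h1) (is_derive_unique _ _ _ h2); ring.
  have d2 : is_derive (fun s => rinner (g s) (g s)) t 0.
    apply: (is_derive_ext_loc (fun _ => 1)); last exact: is_derive_const.
    by move: hs; apply: filter_imp => s ->.
  have := is_derive_unique _ _ _ d1; rewrite (is_derive_unique _ _ _ d2); lra.
Qed.

Lemma le_of_derive_nonpos (f df : R -> R) a b : a < b ->
  (forall t, a < t < b -> is_derive f t (df t)) ->
  (forall t, a <= t <= b -> continuous f t) ->
  (forall t, a < t < b -> df t <= 0) -> f b <= f a.
Proof.
  move=> hab hd hc hn.
  have pr t : a < t < b -> derivable_pt f t.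
    by move=> ht; exists (df t); apply/is_derive_Reals/hd.
  have [|t ht|t [ht e]] := MVT f id a b pr (fun t _ => derivable_pt_id t) hab.
  - by move=> t ht; apply/continuity_pt_filterlim/hc.
  - exact: derivable_continuous_pt (derivable_pt_id t).
  rewrite derive_pt_id Derive_Reals (is_derive_unique _ _ _ (hd t ht)) /id in e.
  have := hn t ht; nra.
Qed.

(* [Re (e^(i h) z_j)] at [z = g t]. *)
Definition rotated_height n (g : R -> 'I_n.+1 -> C) (j : 'I_n.+1) (h t : R) : R :=
  cos h * Re (g t j) - sin h * Im (g t j).

(* [acos] is not differentiable at [1] and [-1]; the factor [kappa < 1] keeps its
   argument inside, and tends to [1] in [angle_le_length]. *)
Lemma angle_increment_on_piece n (g : R -> 'I_n.+1 -> C) j a b h0 eta kappa :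
  a < b -> 0 <= kappa < 1 ->
  (forall t, a <= t <= b -> on_sphere (g t)) ->
  (forall j, C1_on a b (fun t => g t j)) ->
  (forall t, a < t < b -> rinner (velocity g t) (Tfield (g t)) = 0) ->
  let speed t := enorm (velocity g t) in
  ex_RInt speed a b /\
  acos (kappa * rotated_height n g j (h0 + eta * RInt speed a b) b) <=
  acos (kappa * rotated_height n g j h0 a) + sqrt (1 + eta ^ 2) * RInt speed a b.
Proof.
  move=> hab hk sph c1 hor speed.
  have [f' hf'] := fin_all_exists (fun j => proj2 (c1 j)).
  (* A continuous version of the speed: at the end points [velocity] may take default values,
     whereas [f'] has the one-sided limits. *)
  pose V t := enorm (fun i => f' i (clamp a b t)).
  have cV t : continuous V t.
    apply: continuous_enorm => i; apply: continuous_clamp; first lra.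
    exact: (proj1 (hf' i)).
  have V0 t : 0 <= V t by exact: enorm_ge0.
  have hv t : a < t < b -> forall i, velocity g t i = f' i t.
    move=> ht i; have d := proj2 (hf' i) t ht.
    rewrite /velocity (is_derive_unique _ _ _ (is_derive_Re _ _ _ d))
      (is_derive_unique _ _ _ (is_derive_Im _ _ _ d)).
    by case: (f' i t).
  have Vs t : a < t < b -> V t = speed t.
    move=> ht; rewrite /V /speed clamp_id; last lra.
    by apply: enorm_ext => i; rewrite hv.
  have iV c d : ex_RInt V c d by apply: ex_RInt_continuous => t _; exact: cV.
  have Vs' : forall t, Rmin a b < t < Rmax a b -> V t = speed t.
    by rewrite Rmin_left ?Rmax_right; [exact: Vs|lra|lra].
  split; first by apply: ex_RInt_ext (iV a b); exact: Vs'.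
  rewrite -(RInt_ext _ _ _ _ Vs').
  (* Arc length from [a]; the rotation angle [h0 + eta * s t] therefore has derivative
     [eta * V t]. *)
  pose s t := RInt V a t.
  have ds t : is_derive s t (V t).
    apply: (is_derive_RInt V s a t) => //.
    by apply: filter_forall => u; apply: RInt_correct.
  have sa : s a = 0 by exact: RInt_point.
  pose G1 t := Re (g (clamp a b t) j).
  pose G2 t := Im (g (clamp a b t) j).
  pose X t := cos (h0 + eta * s t) * G1 t - sin (h0 + eta * s t) * G2 t.
  have Xg t : a <= t <= b -> X t = rotated_height n g j (h0 + eta * s t) t.
    by move=> ht; rewrite /X /G1 /G2 clamp_id.
  have cg t : @continuous R_UniformSpace C_UniformSpace (fun u => g (clamp a b u) j) t.
    apply: (continuous_clamp _ (fun u => g u j)); first lra.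
    exact: (proj1 (c1 j)).
  have cG1 t : continuous G1 t.
    apply: (continuous_comp (V := C_UniformSpace) _ fst); first exact: cg.
    by rewrite [g (clamp a b t) j]surjective_pairing; exact: continuous_fst.
  have cG2 t : continuous G2 t.
    apply: (continuous_comp (V := C_UniformSpace) _ snd); first exact: cg.
    by rewrite [g (clamp a b t) j]surjective_pairing; exact: continuous_snd.
  have ch t : continuous (fun u => h0 + eta * s u) t.
    apply: (ex_derive_continuous (V := R_NormedModule)); auto_derive.
    by have : ex_derive s t by [eexists; exact: ds]; tauto.
  have cX t : continuous X t.
    apply: (continuous_minus (V := R_NormedModule));
      apply: (continuous_mult (K := R_AbsRing)) => //.
      exact: (continuous_comp _ cos _ (ch t) (continuous_cos _)).
    exact: (continuous_comp _ sin _ (ch t) (continuous_sin _)).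
  have X1 t : X t ^ 2 <= 1.
    have hc := clamp_bounds a b t ltac:(lra).
    have /on_sphere_rinner hz := sph _ hc.
    have := rinner_ge_coord _ (g (clamp a b t)) j; rewrite hz -/(G1 t) -/(G2 t) /X.
    have := sin2_cos2 (h0 + eta * s t); rewrite /Rsqr.
    move: (cos _) (sin _) (G1 t) (G2 t) => c u x y h1 h2.
    (* The discarded square is that of the imaginary part of the rotated coordinate. *)
    have : 0 <= (c * y + u * x) ^ 2 by exact: pow2_ge_0.
    have : (c * x - u * y) ^ 2 + (c * y + u * x) ^ 2 = (u * u + c * c) * (x ^ 2 + y ^ 2) by ring.
    by rewrite h1; lra.
  have kX t : -1 < kappa * X t < 1.
    by have := X1 t; have := pow2_ge_0 (X t) => ? ?; split; nra.
  pose dX t := cos (h0 + eta * s t) * (Re (f' j t) - eta * V t * Im (g t j))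
             - sin (h0 + eta * s t) * (Im (f' j t) + eta * V t * Re (g t j)).
  have dXd t : a < t < b -> is_derive X t (dX t).
    move=> ht; have d := proj2 (hf' j) t ht.
    have d1 : is_derive G1 t (Re (f' j t)).
      apply: (is_derive_ext_loc (fun u => Re (g u j))); last exact: is_derive_Re.
      by apply: filter_imp (locally_clamp _ (fun u => Re (g u j)) a b t ht) => u e; symmetry; exact: e.
    have d2 : is_derive G2 t (Im (f' j t)).
      apply: (is_derive_ext_loc (fun u => Im (g u j))); last exact: is_derive_Im.
      by apply: filter_imp (locally_clamp _ (fun u => Im (g u j)) a b t ht) => u e; symmetry; exact: e.
    have e1 : ex_derive G1 t by eexists; exact: d1.
    have e2 : ex_derive G2 t by eexists; exact: d2.
    have e3 : ex_derive s t by eexists; exact: ds.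
    rewrite /X; auto_derive; first by tauto.
    rewrite (is_derive_unique _ _ _ d1) (is_derive_unique _ _ _ d2) (is_derive_unique _ _ _ (ds t)).
    have g1 : Re (g t j) = G1 t by rewrite /G1 clamp_id; last lra.
    have g2 : Im (g t j) = G2 t by rewrite /G2 clamp_id; last lra.
    by rewrite /dX g1 g2; ring.
  have dXb t : a < t < b -> dX t ^ 2 <= (1 + eta ^ 2) * V t ^ 2 * (1 - X t ^ 2).
    move=> ht; have hz := sph t ltac:(lra); move/on_sphere_rinner: (hz) => {}hz.
    have h1 : rinner (fun i => f' i t) (g t) = 0.
      apply: velocity_orthogonal; first by move=> i; exact: (proj2 (hf' i) t ht).
      apply: filter_imp (locally_clamp _ (fun u => rinner (g u) (g u)) a b t ht) => u <-.
      by apply/on_sphere_rinner/sph/clamp_bounds; lra.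
    have h2 : rinner (fun i => f' i t) (Tfield (g t)) = 0.
      by rewrite -(hor t ht); apply: rinner_ext => i //; rewrite hv.
    have [_] := rotated_height_speed n (g t) (fun i => f' i t) j (h0 + eta * s t) (eta * V t) hz h1 h2.
    have -> : rinner (fun i => f' i t) (fun i => f' i t) = V t ^ 2.
      by rewrite /V enorm_sqr clamp_id; last lra.
    rewrite -/(dX t) -/(rotated_height n g j (h0 + eta * s t) t) -Xg; last lra.
    have -> : V t ^ 2 + (eta * V t) ^ 2 = (1 + eta ^ 2) * V t ^ 2 by ring.
    by [].
  set M := sqrt (1 + eta ^ 2).
  have M0 : 0 <= M by exact: sqrt_pos.
  have M2 : M ^ 2 = 1 + eta ^ 2 by rewrite pow2_sqrt //; nra.
  (* [Psi] is nonincreasing, as the derivative of the angle [acos (kappa * X t)] is at most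
     [M * V t]. *)
  pose Psi t := acos (kappa * X t) - M * s t.
  have main : Psi b <= Psi a.
    apply: (le_of_derive_nonpos _ (fun t => - (kappa * dX t) / sqrt (1 - (kappa * X t) ^ 2) - M * V t)) => //.
    - move=> t ht.
      apply: (is_derive_minus (V := R_NormedModule)); last exact: is_derive_scal.
      have -> : - (kappa * dX t) / sqrt (1 - (kappa * X t) ^ 2) =
        scal (kappa * dX t) (- / sqrt (1 - (kappa * X t) ^ 2)).
        by rewrite /scal /= /mult /= /Rdiv; ring.
      apply: (is_derive_comp acos); first exact: is_derive_acos.
      by apply: is_derive_scal; exact: dXd.
    - move=> t _; apply: (continuous_minus (V := R_NormedModule)).
        apply: (continuous_comp (fun u => kappa * X u) acos).
          by apply: (continuous_mult (K := R_AbsRing)) => //; exact: continuous_const.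
        by apply: (ex_derive_continuous (V := R_NormedModule)); eexists; exact: is_derive_acos.
      by apply: (ex_derive_continuous (V := R_NormedModule)); eexists; apply: is_derive_scal; exact: ds.
    - move=> t ht.
      have hp : 0 < 1 - (kappa * X t) ^ 2 by have := kX t; nra.
      have hS := sqrt_lt_R0 _ hp.
      have S2 : sqrt (1 - (kappa * X t) ^ 2) ^ 2 = 1 - (kappa * X t) ^ 2 by rewrite pow2_sqrt //; lra.
      move: hS S2; set S := sqrt _ => hS S2.
      have hb := dXb t ht.
      have MV : 0 <= M * V t by apply: Rmult_le_pos.
      have hk2 : kappa ^ 2 <= 1 by nra.
      have sq : (kappa * dX t) ^ 2 <= (M * V t * S) ^ 2.
        have -> : (M * V t * S) ^ 2 = M ^ 2 * V t ^ 2 * S ^ 2 by ring.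
        have -> : (kappa * dX t) ^ 2 = kappa ^ 2 * dX t ^ 2 by ring.
        rewrite M2 S2.
        have hc := Rmult_le_compat_l _ _ _ (pow2_ge_0 kappa) hb.
        apply: Rle_trans hc _.
        have c0 : 0 <= (1 + eta ^ 2) * V t ^ 2 by apply: Rmult_le_pos; [nra|exact: pow2_ge_0].
        (* It remains to use [kappa ^ 2 <= 1] inside the last factor. *)
        have -> : kappa ^ 2 * ((1 + eta ^ 2) * V t ^ 2 * (1 - X t ^ 2)) =
          (1 + eta ^ 2) * V t ^ 2 * (kappa ^ 2 - (kappa * X t) ^ 2) by ring.
        by apply: Rmult_le_compat_l => //; lra.
      have [h1 _] := pow2_le_abs _ _ sq (Rmult_le_pos _ _ MV (Rlt_le _ _ hS)).
      suff : - (kappa * dX t) / S <= M * V t by lra.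
      by apply/(Rle_div_l _ _ _ hS); lra.
  move: main; rewrite /Psi sa !Xg ?sa ?Rmult_0_r ?Rplus_0_r; [|lra|lra].
  by rewrite -/(s b); lra.
Qed.


(** * From the rotated angle to a lower bound on length *)

Lemma acos_le_of_cos_le x beta : -1 <= x <= 1 -> 0 <= beta <= PI -> cos beta <= x -> acos x <= beta.
Proof.
  move=> hx hb h; case: (Rle_lt_dec (acos x) beta) => // hlt.
  have ha := acos_bound x.
  have := cos_decreasing_1 beta (acos x) ltac:(lra) ltac:(lra) ltac:(lra) ltac:(lra) hlt.
  by rewrite cos_acos //; lra.
Qed.

(** The triangle inequality in a right spherical triangle with legs [acos x] and [delta], whose
    hypotenuse has cosine [cos delta * x]. It bounds the loss caused by [kappa = cos delta]. *)
Lemma acos_le_acos_cos_mul delta x : 0 <= delta <= PI / 2 -> -1 <= x <= 1 ->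
  acos x <= acos (cos delta * x) + delta.
Proof.
  move=> hd hx; have hpi := PI_RGT_0.
  have sd : 0 <= sin delta by apply: sin_ge_0; lra.
  have c0 : 0 <= cos delta by apply: cos_ge_0; lra.
  have c1 := COS_bound delta.
  have x2 : x ^ 2 <= 1 by nra.
  have hy : -1 <= cos delta * x <= 1 by split; nra.
  have ha := acos_bound (cos delta * x).
  case: (Rle_lt_dec PI (acos (cos delta * x) + delta)) => hlt.
    by have := acos_bound x; lra.
  apply: acos_le_of_cos_le => //; first lra.
  rewrite cos_plus cos_acos //.
  have sa : 0 <= sin (acos (cos delta * x)) by apply: sin_ge_0; lra.
  have := sin2_cos2 (acos (cos delta * x)); have := sin2_cos2 delta.
  rewrite cos_acos // /Rsqr; move: sa sd c0; set S := sin (acos _).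
  move: (sin delta) (cos delta) => sd cd sa sd0 cd0 h1 h2.
  (* Since x^2 <= 1, (x sin delta)^2 <= 1 - (x cos delta)^2 = S^2. *)
  have h3 : - S <= x * sd <= S by apply: pow2_le_abs => //; nra.
  have : 0 <= sd * (x * sd + S) by apply: Rmult_le_pos; lra.
  have -> : x = x * (sd * sd + cd * cd) by rewrite h1; ring.
  have : x * (sd * sd + cd * cd) = x by rewrite h1; ring.
  nra.
Qed.

Lemma angle_le_length n (g : R -> 'I_n.+1 -> C) j eta :
  horizontal_curve g -> g 0 j = RtoC 1 ->
  let l := curve_length g in
  0 <= l /\ acos (rotated_height n g j (eta * l) 1) <= sqrt (1 + eta ^ 2) * l.
Proof.
  move=> [sph [m [s [s0 [s1 hs]]]]] g0 l.
  have mono i : (i <= m)%nat -> s i <= 1.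
    move=> hi; rewrite -s1 -(subnK hi); move: (m - i)%nat (subnK hi) => d.
    elim: d i {hi} => [|d IH] i hd; first by rewrite add0n; lra.
    have hi : (i < m)%nat by rewrite -hd addSn ltnS leq_addl.
    have [h _] := hs i hi.
    by have := IH i.+1; rewrite addnS -addSn hd => /(_ erefl); lra.
  pose speed t := enorm (velocity g t).
  (* The bounds on the pieces telescope for a fixed [kappa]: each piece starts with the angle
     reached at the end of the previous one. *)
  have key kappa : 0 <= kappa < 1 -> forall i, (i <= m)%nat -> 0 <= s i /\ ex_RInt speed 0 (s i) /\
      acos (kappa * rotated_height n g j (eta * RInt speed 0 (s i)) (s i)) <=
      acos kappa + sqrt (1 + eta ^ 2) * RInt speed 0 (s i).
    move=> hk; elim => [|i IH] hi.
      rewrite s0 RInt_point; split; first lra.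
      split; first exact: ex_RInt_point.
      rewrite /rotated_height g0 /zero /= !Rmult_0_r cos_0.
      by apply: Req_le; rewrite Rplus_0_r; f_equal; ring.
    have [p1 [p2 p3]] := IH (ltnW hi).
    have [hlt [hc hh]] := hs i hi.
    have h1 := mono _ hi.
    have [q1 q2] := angle_increment_on_piece n g j (s i) (s i.+1) (eta * RInt speed 0 (s i)) eta kappa hlt hk
       (fun t ht => sph t ltac:(lra)) hc hh.
    split; first lra.
    split; first exact: ex_RInt_Chasles p2 q1.
    have e : RInt speed 0 (s i.+1) = RInt speed 0 (s i) + RInt speed (s i) (s i.+1).
      by rewrite -(RInt_Chasles speed 0 (s i) (s i.+1) p2 q1).
    rewrite e [eta * (_ + _)]Rmult_plus_distr_l [sqrt _ * (_ + _)]Rmult_plus_distr_l.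
    by change (fun t => enorm (velocity g t)) with speed in q2; lra.
  (* Integrability is the same for every [kappa]; 0 is an arbitrary choice. *)
  have [_ [ex _]] := key 0 ltac:(lra) m (leqnn m).
  rewrite s1 in ex.
  split; first by apply: RInt_ge_0 => // [|t _]; [lra|exact: enorm_ge0].
  apply: le_epsilon => eps heps.
  have hpi := PI_RGT_0.
  (* With [kappa = cos delta], one [delta] is lost at the start, as [acos kappa], and one at the
     end, by [acos_le_acos_cos_mul]. *)
  pose delta := Rmin (eps / 2) (PI / 2).
  have hd : 0 < delta by apply: Rmin_glb_lt; lra.
  have hd1 : delta <= eps / 2 by exact: Rmin_l.
  have hd2 : delta <= PI / 2 by exact: Rmin_r.
  have ck : 0 <= cos delta < 1.
    split; first by apply: cos_ge_0; lra.
    by rewrite -cos_0; apply: cos_decreasing_1; lra.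
  have [_ [_ h]] := key _ ck m (leqnn m).
  rewrite s1 acos_cos in h; last lra.
  rewrite -/(curve_length g) -/l in h.
  have hx : -1 <= rotated_height n g j (eta * l) 1 <= 1.
    have /on_sphere_rinner hz := sph 1 ltac:(lra).
    have := rinner_ge_coord _ (g 1) j; rewrite hz /rotated_height.
    have := sin2_cos2 (eta * l); rewrite /Rsqr.
    move: (cos _) (sin _) (Re _) (Im _) => c u x y h1 h2.
    suff /pow2_le_abs/(_ Rle_0_1) : (c * x - u * y) ^ 2 <= 1 ^ 2 by lra.
    have : 0 <= (c * y + u * x) ^ 2 by exact: pow2_ge_0.
    have : (c * x - u * y) ^ 2 + (c * y + u * x) ^ 2 = (u * u + c * c) * (x ^ 2 + y ^ 2) by ring.
    by rewrite h1; lra.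
  have := acos_le_acos_cos_mul delta _ ltac:(lra) hx.
  lra.
Qed.

(** For [eta = - b / l] the total rotation is e^(- i b), which brings [geodesic_end a b] to a number
    of real part [cos a]; so [a <= sqrt (l ^ 2 + b ^ 2)]. *)
Lemma geodesic_length_minimal n (g : R -> 'I_n.+1 -> C) j a b :
  horizontal_curve g -> g 0 j = RtoC 1 -> g 1 j = geodesic_end a b ->
  0 < a <= PI -> b ^ 2 <= a ^ 2 -> sqrt (a ^ 2 - b ^ 2) <= curve_length g.
Proof.
  move=> hg g0 g1 ha hb.
  have hl eta := angle_le_length n g j eta hg g0.
  set l := curve_length g in hl *.
  have l0 : 0 <= l by exact: (proj1 (hl 0)).
  have cs x : cos x * cos x = 1 - sin x * sin x by have := sin2_cos2 x; rewrite /Rsqr; lra.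
  suff h : a ^ 2 - b ^ 2 <= l ^ 2.
    by rewrite -(sqrt_pow2 l) //; apply: sqrt_le_1_alt.
  (* Length 0 is separate because of the division in [eta]. There [eta = 0] forces the end
     coordinate to be 1, hence [cos a = cos b], and |b| <= a <= PI leaves only |b| = a. *)
  case: (Req_dec l 0) => lz; last first.
    have := proj2 (hl (- b / l)).
    have -> : - b / l * l = - b by field.
    have -> : rotated_height n g j (- b) 1 = cos a.
      rewrite /rotated_height g1 /geodesic_end /cis /Cmult /Re /Im /= cos_neg sin_neg.
      by move: (cos b) (sin b) (cs b) => cb sb e; ring [e].
    rewrite acos_cos; last lra.
    have -> : sqrt (1 + (- b / l) ^ 2) * l = sqrt (l ^ 2 + b ^ 2).
      rewrite -{2}(sqrt_pow2 l) // -sqrt_mult; [|nra|nra].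
      by f_equal; field.
    move=> h.
    have h2 : 0 <= l ^ 2 + b ^ 2 by nra.
    have := pow_incr a _ 2 (conj (Rlt_le _ _ (proj1 ha)) h).
    by rewrite pow2_sqrt //; lra.
  rewrite lz.
  have [_] := hl 0; rewrite lz !Rmult_0_r => h.
  have hn : rinner (g 1) (g 1) = 1 by apply/on_sphere_rinner/(proj1 hg); lra.
  have hc := rinner_ge_coord _ (g 1) j; rewrite hn in hc.
  have hR : rotated_height n g j 0 1 = Re (g 1 j) by rewrite /rotated_height cos_0 sin_0; ring.
  rewrite hR in h.
  have hr1 : -1 <= Re (g 1 j) <= 1 by split; nra.
  have e0 : acos (Re (g 1 j)) = 0 by have := acos_bound (Re (g 1 j)); lra.
  have re1 : Re (g 1 j) = 1 by rewrite -(cos_acos (Re (g 1 j))) // e0 cos_0.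
  have im0 : Im (g 1 j) = 0 by rewrite re1 in hc; nra.
  have ca : cos a = cos b.
    have -> : cos a = cos b * Re (g 1 j) + sin b * Im (g 1 j).
      rewrite g1 /geodesic_end /cis /Cmult /Re /Im /=.
      by move: (cos b) (sin b) (cs b) => cb sb e; ring [e].
    by rewrite re1 im0; ring.
  case: (Rle_lt_dec (a ^ 2) (b ^ 2)) => hab; first lra.
  have hb0 := Rabs_pos b.
  have hba : Rabs b < a.
    have : Rabs b ^ 2 < a ^ 2 by rewrite pow2_abs.
    nra.
  have := cos_decreasing_1 (Rabs b) a ltac:(lra) ltac:(lra) ltac:(lra) ltac:(lra) hba.
  by rewrite ca; rewrite /Rabs; case: Rcase_abs => ?; rewrite ?cos_neg; lra.
Qed.

(** * The distance from the north pole *)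

Lemma rinner_north_pole n (q : 'I_n.+1 -> C) :
  rinner q (north_pole n) = Re (q ord_max) /\
  rinner q (Tfield (north_pole n)) = Im (q ord_max).
Proof.
  split; rewrite rinnerE (bigD1 ord_max) //= big1 /north_pole /Tfield ?eqxx /Re /Im /=;
    try ring; move=> i hi; rewrite (negbTE hi) /=; ring.
Qed.

Lemma on_sphere_north_pole n : on_sphere (north_pole n).
Proof.
  apply/on_sphere_rinner; rewrite (proj1 (rinner_north_pole n _)).
  by rewrite /north_pole eqxx.
Qed.

(** The infimum is attained: the geodesic gives a member of the set, and [geodesic_length_minimal]
    bounds all members. Only the last coordinate of [q] enters, being its Hermitian product with the
    pole. *)
Lemma sr_dist_north_pole n (q : 'I_n.+1 -> C) a b : (1 <= n)%nat ->
  on_sphere q -> q ord_max = geodesic_end a b -> 0 < a <= PI -> b ^ 2 <= a ^ 2 ->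
  sr_dist (north_pole n) q = Rbar.Finite (sqrt (a ^ 2 - b ^ 2)).
Proof.
  move=> hn hq e ha hb; apply: is_glb_Rbar_unique; split.
    move=> l [g [hg [g0 [g1 ->]]]].
    apply: (geodesic_length_minimal _ _ ord_max) => //.
      by rewrite g0 /north_pole eqxx.
    by rewrite g1.
  move=> m; apply.
  apply: joining_length_of_geodesic_end => //; first exact: on_sphere_north_pole.
  have [-> ->] := rinner_north_pole n q.
  by rewrite -e -surjective_pairing.
Qed.

Lemma cyl_point_ord_max n (w : 'I_n -> C) r theta : 0 <= r < PI / 2 -> enorm w = tan r ->
  cyl_point w theta ord_max = (RtoC (cos r) * cis theta)%C.
Proof.
  move=> hr hw; rewrite /cyl_point unlift_none hw; f_equal; f_equal.
  have hc : 0 < cos r by apply: cos_gt_0; lra.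
  have -> : 1 + tan r ^ 2 = (/ cos r) ^ 2.
    have := sin2_cos2 r; rewrite /Rsqr /tan => e.
    transitivity ((sin r * sin r + cos r * cos r) * (/ cos r) ^ 2); first by field; lra.
    by rewrite e; ring.
  rewrite sqrt_pow2 ?Rinv_inv //.
  by apply: Rlt_le; apply: Rinv_0_lt_compat.
Qed.

Lemma on_sphere_cyl_point n (w : 'I_n -> C) theta : on_sphere (cyl_point w theta).
Proof.
  apply/on_sphere_rinner; rewrite rinnerE big_ord_recr /=.
  set c := / sqrt (1 + enorm w ^ 2).
  have hp : 0 < 1 + enorm w ^ 2 by have := pow2_ge_0 (enorm w); lra.
  have hs := sqrt_lt_R0 _ hp.
  have cc : c * c * (1 + enorm w ^ 2) = 1.
    by rewrite /c -{3}(sqrt_sqrt (1 + enorm w ^ 2)); [field; lra|lra].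
  have cs : cos theta * cos theta = 1 - sin theta * sin theta.
    by have := sin2_cos2 theta; rewrite /Rsqr; lra.
  have hl (i : 'I_n) : widen_ord (leqnSn n) i = lift ord_max i.
    exact/val_inj/esym/lift_max.
  rewrite (eq_bigr (fun i => (c * c) * (Re (w i) * Re (w i) + Im (w i) * Im (w i)))); last first.
    move=> i _; rewrite hl /cyl_point liftK -/c /cis /Cmult /Re /Im /=.
    by ring [cs].
  rewrite -big_Rmult_distr -rinnerE -enorm_sqr /cyl_point unlift_none -/c.
  rewrite -[RHS]cc /cis /Cmult /Re /Im /=; ring [cs].
Qed.

Lemma sr_dist_cyl_point n (w : 'I_n -> C) r theta a b : (1 <= n)%nat ->
  0 <= r < PI / 2 -> enorm w = tan r ->
  (RtoC (cos r) * cis theta)%C = geodesic_end a b -> 0 < a <= PI -> b ^ 2 <= a ^ 2 ->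
  sr_dist (north_pole n) (cyl_point w theta) = Rbar.Finite (sqrt (a ^ 2 - b ^ 2)).
Proof.
  move=> hn hr hw e; apply: sr_dist_north_pole => //; first exact: on_sphere_cyl_point.
  by rewrite (cyl_point_ord_max _ _ r).
Qed.

(** * The diameter *)

(** A geodesic joins the two points, and its length is at most [a <= PI]. *)
Lemma sr_dist_le_PI n (p q : 'I_n.+1 -> C) : (1 <= n)%nat ->
  on_sphere p -> on_sphere q -> Rbar_le (sr_dist p q) (Rbar.Finite PI).
Proof.
  move=> hn hp hq.
  have [hz _] := hermitian_decomposition n p q 0 hn hp hq.
  have [a [b [ha hb e]]] := geodesic_end_surjective _ hz.
  have h : sqrt (a ^ 2 - b ^ 2) <= sqrt (a ^ 2).
    by apply: sqrt_le_1_alt; have := pow2_ge_0 b; lra.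
  rewrite sqrt_pow2 in h; last lra.
  apply: Rbar_le_trans (proj1 (Glb_Rbar_correct _) _
    (joining_length_of_geodesic_end n p q a b hn hp hq ha hb e)) _.
  exact: Rle_trans h (proj2 ha).
Qed.

Lemma enorm_single n (hn : (0 < n)%nat) x : 0 <= x ->
  enorm (fun k : 'I_n => if k == Ordinal hn then RtoC x else RtoC 0) = x.
Proof.
  move=> hx; rewrite /enorm rinnerE (bigD1 (Ordinal hn)) //= big1.
    by rewrite /Re /Im /= -{3}(sqrt_pow2 x) //; f_equal; ring.
  by move=> k hk; rewrite (negbTE hk) /Re /Im /=; ring.
Qed.

Lemma sr_diameter_PI n : (1 <= n)%nat -> sr_diameter n = Rbar.Finite PI.
Proof.
  move=> hn; have hpi := PI_RGT_0.
  apply: Rbar_is_lub_unique; split.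
    by move=> x [p [q [hp [hq ->]]]]; exact: sr_dist_le_PI.
  move=> m; apply.
  (* The zero vector, in the form required by [enorm_single]. With angle [PI] it gives the antipode
     of the pole, reached with [a = PI] and [b = 0]. *)
  pose w := fun k : 'I_n => if k == Ordinal hn then RtoC 0 else RtoC 0.
  exists (north_pole n), (cyl_point w PI).
  split; first exact: on_sphere_north_pole.
  split; first exact: on_sphere_cyl_point.
  rewrite (sr_dist_cyl_point n w 0 PI PI 0) //; try lra.
  - by f_equal; rewrite -{1}(sqrt_pow2 PI); [f_equal; ring|lra].
  - by rewrite tan_0; apply: enorm_single; lra.
  - rewrite /geodesic_end /cis cos_0 sin_0 cos_PI sin_PI /Cmult /RtoC /=.
    by f_equal; ring.
  - nra.
Qed.

(** * The solution phi and the distance formulas *)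

Lemma Cmod_cis theta : Cmod (cis theta) = 1.
Proof.
  rewrite /Cmod /cis /= -[RHS]sqrt_1; f_equal.
  by have := sin2_cos2 theta; rewrite /Rsqr; lra.
Qed.

Lemma phi_solutionE r theta phi :
  phi_solution r theta phi <-> - PI <= phi <= PI /\ phi_gap (cos r) theta phi = 0.
Proof.
  rewrite /phi_solution /phi_gap -/(angle_quotient (cos r) phi) /acos_quotient.
  by rewrite -/(angle_quotient (cos r) phi); split => -[h e]; split => //; lra.
Qed.

Lemma cos_angle_lt1 r : 0 < r < PI / 2 -> 0 < cos r < 1.
Proof.
  move=> hr; split; first by apply: cos_gt_0; lra.
  by rewrite -cos_0; apply: cos_decreasing_1; lra.
Qed.

Lemma phi_solution_unique r theta : - PI <= theta <= PI -> 0 < r < PI / 2 ->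
  exists phi, unique (phi_solution r theta) phi.
Proof.
  move=> ht hr; have hc := cos_angle_lt1 r hr.
  have hc' : 0 <= cos r < 1 by lra.
  have [phi [h1 h2]] := phi_gap_root (cos r) theta hc' ht.
  exists phi; split; first by apply/phi_solutionE.
  move=> psi /phi_solutionE [_ h3].
  case: (Rtotal_order phi psi) => [hlt|[//|hlt]].
    by have := phi_gap_increasing _ theta _ _ hc' hlt; lra.
  by have := phi_gap_increasing _ theta _ _ hc' hlt; lra.
Qed.

(** Dividing the equation by [sin phi] gives the value that the other branch takes by definition. *)
Lemma phi_quotientE r theta phi : 0 < r < PI / 2 -> phi_solution r theta phi ->
  phi_quotient r theta phi = cos r * angle_quotient (cos r) phi.
Proof.
  move=> hr [_ e]; rewrite /phi_quotient; case: Req_EM_T => //= h.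
  by rewrite e /acos_quotient -/(angle_quotient (cos r) phi); field.
Qed.

Theorem mainTheorem12 :
  forall n : nat, (1 <= n)%nat ->
  (exists d : R -> R -> R,
    (forall (w : 'I_n -> C) (r theta : R),
       0 <= r < PI / 2 -> enorm w = tan r ->
       sr_dist (north_pole n) (cyl_point w theta) = Rbar.Finite (d r theta)) /\
    (forall theta : R, - PI <= theta <= PI ->
       d 0 theta ^ 2 = 2 * PI * Rabs theta - theta ^ 2) /\
    (forall r theta : R, - PI <= theta <= PI -> 0 < r < PI / 2 ->
       exists phi : R,
         unique (phi_solution r theta) phi /\
         d r theta ^ 2 = phi_quotient r theta phi ^ 2 * tan r ^ 2)) /\
  sr_diameter n = Rbar.Finite PI.
Proof.
  move=> n hn; split; last exact: sr_diameter_PI.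
  have hpi := PI_RGT_0.
  (* One representative of each radius, from which [d] is defined; [real] would send an infinite
     distance to 0, but the distances are finite for [0 <= r < PI / 2]. *)
  pose w0 r := fun k : 'I_n => if k == Ordinal hn then RtoC (tan r) else RtoC 0.
  have hw0 r : 0 <= r < PI / 2 -> enorm (w0 r) = tan r.
    move=> hr; apply: enorm_single; case: (Req_dec r 0) => [->|r0]; first by rewrite tan_0; lra.
    by apply: Rlt_le; apply: tan_gt_0; lra.
  pose d r theta := real (sr_dist (north_pole n) (cyl_point (w0 r) theta)).
  have dE r theta a b : 0 <= r < PI / 2 ->
      (RtoC (cos r) * cis theta)%C = geodesic_end a b -> 0 < a <= PI -> b ^ 2 <= a ^ 2 ->
      d r theta = sqrt (a ^ 2 - b ^ 2).
    move=> hr e ha hb.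
    by rewrite /d (sr_dist_cyl_point n (w0 r) r theta a b hn hr (hw0 r hr) e ha hb).
  exists d; split; last split.
  - move=> w r theta hr hw.
    (* The same [a] and [b] serve for [w] and for [w0 r], whence independence of [w]. Here [theta]
       is any real. *)
    have [a [b [ha hb e]]] : exists a b, [/\ 0 < a <= PI, b ^ 2 <= a ^ 2
        & (RtoC (cos r) * cis theta)%C = geodesic_end a b].
      apply: geodesic_end_surjective.
      rewrite Cmod_mult Cmod_R Cmod_cis.
      by have := COS_bound r; rewrite Rmult_1_r => ?; apply: Rabs_le.
    rewrite (sr_dist_cyl_point n w r theta a b hn hr hw e ha hb).
    by rewrite (dE r theta a b).
  - move=> theta ht.
    have [b [hb e eb]] := geodesic_end_vertical theta ht.
    rewrite (dE 0 theta PI b) //; try lra; last by rewrite cos_0 Cmult_1_l.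
    by rewrite pow2_sqrt; lra.
  - move=> r theta ht hr.
    have hc := cos_angle_lt1 r hr.
    have [phi hphi] := phi_solution_unique r theta ht hr.
    exists phi; split=> //.
    have /phi_solutionE [_ h0] := proj1 hphi.
    have [ha hb e eab] := geodesic_end_of_phi (cos r) theta phi ltac:(lra) h0.
    rewrite (dE r theta _ _ ltac:(lra) e ha hb) pow2_sqrt; last by move: hb; lra.
    rewrite eab (phi_quotientE _ _ _ hr (proj1 hphi)).
    (* Both sides are then sin^2 r times the square of [angle_quotient (cos r) phi]. *)
    have -> : 1 - cos r ^ 2 = sin r ^ 2 by have := sin2_cos2 r; rewrite /Rsqr /=; lra.
    by rewrite /tan; field; lra.
Qed.
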